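(* Let $G$ be an infinite abelian group, and let $H \in \mathbb{N}$ and $m_1, \ldots, m_H \in \mathbb{Z}$. Then there exist finite sets $A,B \subseteq G$ such that $$|hA|-|hB|=m_h$$ for each $1 \leq h \leq H$.
   Context: $\mathbb{N}$ denotes the positive integers. For a subset $A$ of an abelian group $G$ and $h \in \mathbb{N}$, the $h$-fold iterated sumset is $hA:=\{a_1+\cdots+a_h : a_1,\ldots,a_h \in A\}$ (repetitions allowed). $|X|$ denotes the cardinality of a finite set $X$. *)

(* Defs.v *)
From mathcomp Require Import all_boot all_order all_algebra.
From mathcomp Require Import finmap.

Set Implicit Arguments.
Unset Strict Implicit.
Unset Printing Implicit Defensive.

Import GRing.Theory.
Local Open Scope fset_scope.
Local Open Scope ring_scope.

(* The family [a] ranges over all functions from 'I_h to the finite subtype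
   of elements of [A], so repetitions are allowed. *)
Definition sumset (G : zmodType) (h : nat) (A : {fset G}) : {fset G} :=
  [fset \sum_(i < h) val (a i) | a : {ffun 'I_h -> A} in {: {ffun 'I_h -> A}}].

Lemma sumsetP (G : zmodType) (h : nat) (A : {fset G}) (x : G) :
  reflect (exists2 a : 'I_h -> G, forall i, a i \in A & x = \sum_(i < h) a i)
          (x \in sumset h A).
Proof.
apply: (iffP (imfsetP _ _ _ _)) => /= [[a _ ->]|[a aA ->]].
  by exists (fun i => val (a i)) => // i; apply: valP.
exists [ffun i => [` aA i]] => //.
by apply: eq_bigr => i _; rewrite ffunE.
Qed.

(* Main.v *)
(* Let K be the index set {0, .., H-1}. Given a large finite set L, generic
   elements e_i and sets P_i in L, put
     D = L u U_i (2 e_i + L),   A = D u U_i (e_i + P_i).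
   Then hA is the disjoint union of D + (h-1)A and of the cells
   sum_(i in I) (e_i + P_i) with |I| = h. If P_0 is replaced by a P'_0 with
   L + P_0 = L + P'_0, the part D + (h-1)A does not change, so that |hA|
   changes by the sum over J, |J| = h-1, of |P_0 + C_J| - |P'_0 + C_J| with
   C_J = sum_(i in J) P_i. Such differences are additive under far translates,
   and for independent C_i = {0, c_i, d_i} products of small sets realize every
   integer-valued function of J, because the pairs (|Z|, |Z + C_i|) generate Z^2.

   Genericity is understood modulo a q <> 1 for which the q-torsion is infinite
   and meets every c-torsion, c not divisible by q, in a finite set. *)

Require Import Defs.
From HB Require Import structures.
From mathcomp Require Import all_boot all_order all_algebra.
From mathcomp Require Import finmap.
From mathcomp Require Import boolp classical_sets cardinality.

Set Implicit Arguments.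
Unset Strict Implicit.
Unset Printing Implicit Defensive.

Import GRing.Theory.
Local Open Scope fset_scope.
Local Open Scope ring_scope.

(** * Minkowski sums *)

Section MinkowskiSum.
Variable G : zmodType.
Implicit Types (X Y Z : {fset G}) (x y t : G).

Definition msum X Y : {fset G} := [fset x + y | x in X, y in Y].

Lemma msumP X Y z :
  reflect (exists2 x, x \in X & exists2 y, y \in Y & z = x + y)
          (z \in msum X Y).
Proof. exact: imfset2P. Qed.

Lemma mem_msum X Y x y : x \in X -> y \in Y -> x + y \in msum X Y.
Proof. by move=> xX yY; apply/msumP; exists x => //; exists y. Qed.

Lemma msumC : commutative msum.
Proof.
suff sub X Y : {subset msum X Y <= msum Y X}.
  by move=> X Y; apply/fsetP => z; apply/idP/idP; apply: sub.
by move=> _ /msumP[x xX [y yY ->]]; rewrite addrC mem_msum.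
Qed.

Lemma msumA : associative msum.
Proof.
move=> X Y Z; apply/fsetP => z; apply/idP/idP.
  move=> /msumP[x xX [_ /msumP[y yY [t tZ ->]] ->]].
  by rewrite addrA !mem_msum.
move=> /msumP[_ /msumP[x xX [y yY ->]] [t tZ ->]].
by rewrite -addrA !mem_msum.
Qed.

Lemma msum0 : left_id [fset 0] msum.
Proof.
move=> X; apply/fsetP => z; apply/idP/idP.
  by move=> /msumP[x /fset1P -> [y yX ->]]; rewrite add0r.
by move=> zX; rewrite -[z]add0r mem_msum ?fset11.
Qed.

HB.instance Definition _ :=
  Monoid.isComLaw.Build {fset G} [fset 0] msum msumA msumC msum0.

Lemma msumS X X' Y Y' : X `<=` X' -> Y `<=` Y' -> msum X Y `<=` msum X' Y'.
Proof.
move=> /fsubsetP sX /fsubsetP sY; apply/fsubsetP => _ /msumP[x xX [y yY ->]].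
by rewrite mem_msum ?sX ?sY.
Qed.

Lemma msumUl X Y Z : msum (X `|` Y) Z = msum X Z `|` msum Y Z.
Proof.
apply/fsetP => z; apply/idP/fsetUP.
  move=> /msumP[x /fsetUP[] xX [y yZ ->]]; [left|right]; exact: mem_msum.
by move=> [] /msumP[x xX [y yZ ->]]; rewrite mem_msum // inE xX ?orbT.
Qed.

Lemma msumUr X Y Z : msum Z (X `|` Y) = msum Z X `|` msum Z Y.
Proof. by rewrite ![msum Z _]msumC msumUl. Qed.

Lemma msum_fset0 X : msum fset0 X = fset0.
Proof. by apply/fsetP => z; apply/idP => /msumP[x]; rewrite inE. Qed.

Lemma msum_translateP t X z :
  reflect (exists2 x, x \in X & z = t + x) (z \in msum [fset t] X).
Proof.
apply: (iffP (msumP _ _ _)) => [[_ /fset1P-> [x xX ->]]|[x xX ->]].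
  by exists x.
by exists t; rewrite ?fset11 //; exists x.
Qed.

Lemma card_translate t X : #|` msum [fset t] X| = #|` X|.
Proof.
rewrite (_ : msum _ _ = [fset t + x | x in X]).
  by rewrite card_imfset //=; exact: addrI.
by apply/fsetP => z; apply/msum_translateP/imfsetP => /= -[x xX ->]; exists x.
Qed.

(** Since [r] has no repetition, a single function on [I] can record the term chosen at each
    index. *)
Lemma mem_big_msum (I : eqType) (r : seq I) (W : I -> {fset G}) z : uniq r ->
  reflect (exists2 w : I -> G, forall i, i \in r -> w i \in W i
                             & z = \sum_(i <- r) w i)
          (z \in \big[msum/[fset 0]]_(i <- r) W i).
Proof.
elim: r z => [|i r IH] z /=.
  rewrite big_nil => _; apply: (iffP (fset1P _ _)) => [->|[w _ ->]].
    by exists (fun=> 0); rewrite ?big_nil.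
  by rewrite big_nil.
case/andP=> ir ur; rewrite big_cons; apply: (iffP (msumP _ _ _)).
  move=> [x xW [y /IH -/(_ ur)[w wW ->] ->]].
  exists (fun j => if j == i then x else w j).
    by move=> j; rewrite inE; case: eqP => [->|_] //=; apply: wW.
  rewrite big_cons eqxx; congr (_ + _); apply: eq_big_seq => j jr.
  by case: eqP ir => // <-; rewrite jr.
move=> [w wW ->]; exists (w i); first by rewrite wW ?mem_head.
exists (\sum_(j <- r) w j); last by rewrite big_cons.
by apply/IH => //; exists w => // j jr; rewrite wW ?inE ?jr ?orbT.
Qed.

Lemma sumset_msum h X : sumset h X = \big[msum/[fset 0]]_(i < h) X.
Proof.
apply/fsetP => z; apply/sumsetP/mem_big_msum; first exact: index_enum_uniq.
  by move=> [a aX ->]; exists a.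
by move=> [a aX ->]; exists a => // i; rewrite aX ?mem_index_enum.
Qed.

Lemma sumset0 X : sumset 0 X = [fset 0].
Proof. by rewrite sumset_msum big_ord0. Qed.

Lemma sumsetS h X : sumset h.+1 X = msum X (sumset h X).
Proof. by rewrite !sumset_msum big_ord_recl. Qed.

(** Sums are padded with zeros. *)
Lemma sumset_widen h k X : 0 \in X -> (h <= k)%N -> sumset h X `<=` sumset k X.
Proof.
move=> X0 /subnK <-; elim: (k - h)%N => [|j IH]; first exact: fsubset_refl.
rewrite addSn sumsetS; apply: fsubset_trans IH _.
by rewrite -{1}[sumset _ X]msum0 msumS // fsub1set.
Qed.

Lemma sum_in_sumset (I : finType) (A : {set I}) (a : I -> G) X :
  (forall i, i \in A -> a i \in X) -> \sum_(i in A) a i \in sumset #|A| X.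
Proof.
move=> aX; rewrite sumset_msum big_const_ord -big_const -big_enum -[X in _ \in X]big_enum.
by apply/mem_big_msum; [exact: enum_uniq|exists a => // i; rewrite mem_enum; apply: aX].
Qed.

End MinkowskiSum.
Arguments msum {G} X Y.

(** * Cardinalities of disjoint unions *)

Section Cardinality.
Variable T : choiceType.

Lemma card_fsetU_disjoint (A B : {fset T}) :
  (forall x, x \in A -> x \in B -> False) -> #|` A `|` B| = (#|` A| + #|` B|)%N.
Proof.
move=> dAB; rewrite -cardfsUI (_ : A `&` B = fset0) ?cardfs0 ?addn0 //.
by apply/fsetP => x; rewrite !inE; apply/andP => -[/dAB].
Qed.

Lemma card_bigfcup_disjoint (I : finType) (P : pred I) (S : I -> {fset T}) :
  (forall i j x, P i -> P j -> x \in S i -> x \in S j -> i = j) ->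
  #|` \bigcup_(i | P i) S i| = \sum_(i | P i) #|` S i|.
Proof.
move=> dS; elim: (index_enum I) (index_enum_uniq I) => [|i r IH] /=.
  by rewrite !big_nil cardfs0.
case/andP=> ir /IH {}IH; rewrite !big_cons; case: ifP => // Pi.
rewrite card_fsetU_disjoint ?IH // => x xi /bigfcupP[j /andP[jr Pj] xj].
by move: ir; rewrite (dS _ _ _ Pi Pj xi xj) jr.
Qed.

End Cardinality.

(** * Generic elements *)

Section GenericElements.
Variable G : zmodType.
Implicit Types F : {fset G}.

Definition torsion (q : nat) : set G := [set e : G | e *+ q = 0]%classic.

Lemma torsion_gcd (e : G) a b : (0 < a)%N ->
  e *+ a = 0 -> e *+ b = 0 -> e *+ gcdn a b = 0.
Proof.
move=> a0 ea eb; case: (egcdnP b a0) => u v uv _.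
have: e *+ (u * a) = e *+ (v * b + gcdn a b) by rewrite uv.
by rewrite mulrnDr [(u * a)%N]mulnC [(v * b)%N]mulnC !mulrnA ea eb !mul0rn add0r.
Qed.

(* [q] is the least positive integer whose torsion is infinite, or 0 if there
   is none; in the latter case [torsion q] is the whole group. *)
Lemma critical_torsion : infinite_set [set: G]%classic ->
  exists q, [/\ q != 1%N, infinite_set (torsion q) &
    forall c, ~~ (q %| c)%N -> finite_set (torsion q `&` torsion c)%classic].
Proof.
move=> infG; pose bad c := `[< (0 < c)%N /\ infinite_set (torsion c) >].
have [/ex_minnP[q /asboolP[q0 infq] qmin]|nobad] := pselect (exists c, bad c).
  exists q; split=> //.
    apply/eqP => q1; apply: infq; rewrite q1.
    by apply: sub_finite_set (finite_set1 (0 : G)) => e; rewrite /torsion /= mulr1n.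
  move=> c qc; apply: contrapT => infqc.
  (* By Bezout, elements killed by [q] and [c] are killed by their gcd, so an infinite intersection
     makes the gcd bad; minimality of [q] then forces [q] to divide [c]. *)
  have : bad (gcdn q c).
    apply/asboolP; split; first by rewrite gcdn_gt0 q0.
    by apply: sub_infinite_set infqc => e [eq ec]; exact: torsion_gcd.
  move=> /qmin le; case/negP: qc; apply/gcdn_idPl/eqP.
  by rewrite eqn_leq le dvdn_leq // dvdn_gcdl.
exists 0%N; split=> //.
  by apply: sub_infinite_set infG => e _; rewrite /torsion /= mulr0n.
move=> c; rewrite dvd0n -lt0n => c0; apply: contrapT => inf.
apply: nobad; exists c; apply/asboolP; split=> //.
by apply: sub_infinite_set inf; exact: subIsetr.
Qed.

(** Coefficients can only be recovered modulo [q], because [q] kills every [e i]; for [q = 0] this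
    means equality. The set [F] collects the error terms to be tolerated. *)
Definition generic (q N : nat) F (I : finType) (e : I -> G) :=
  (forall i, e i *+ q = 0) /\
  forall k l : I -> nat, (forall i, k i <= N)%N -> (forall i, l i <= N)%N ->
  forall f f', f \in F -> f' \in F ->
  \sum_i e i *+ k i + f = \sum_i e i *+ l i + f' ->
  forall i, k i = l i %[mod q].

Section Critical.
Variable q : nat.
Hypothesis q_inf : infinite_set (torsion q).
Hypothesis q_crit :
  forall c, ~~ (q %| c)%N -> finite_set (torsion q `&` torsion c)%classic.

(** A nonempty fibre is a coset of the intersection of the two torsion subgroups. *)
Lemma fiber_finite c f : ~~ (q %| c)%N ->
  finite_set (torsion q `&` [set e | e *+ c = f])%classic.
Proof.
move=> qc; have [[e0 [e0q e0c]]|none] :=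
  pselect (exists e0, torsion q e0 /\ e0 *+ c = f); last first.
  by apply: sub_finite_set (finite_set0 G) => e [eq ec]; apply: none; exists e.
apply: sub_finite_set (finite_image (fun y => e0 + y) (q_crit qc)) => e [eq ec].
exists (e - e0); last by rewrite addrC subrK.
by split; rewrite /torsion /= mulrnBl ?e0c ?ec ?e0q ?eq subrr.
Qed.

Lemma mulrn_modq (e : G) k l : e *+ q = 0 -> k = l %[mod q] -> e *+ k = e *+ l.
Proof.
move=> eq kl; rewrite (divn_eq k q) (divn_eq l q) kl !mulrnDr.
by rewrite ![(_ * q)%N]mulnC !mulrnA eq !mul0rn.
Qed.

(** A bad [e] satisfies [e *+ c = f' - f] with [c = k - l] at most [N] and not divisible by [q].
    These are finitely many finite fibres, which cannot exhaust the infinite [q]-torsion. *)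
Lemma generic1 N F : exists2 e, e *+ q = 0 &
  forall k l f f', (k <= N)%N -> (l <= N)%N -> f \in F -> f' \in F ->
  e *+ k + f = e *+ l + f' -> k = l %[mod q].
Proof.
pose D := [fset f' - f | f in F, f' in F].
have: finite_set (\bigcup_(c in [set c : nat | (c < N.+1)%N /\ ~~ (q %| c)%N])
  \bigcup_(f in [set` D]) (torsion q `&` [set e | e *+ c = f]))%classic.
  apply: bigcup_finite => [|c [_ qc]].
    by apply: sub_finite_set (finite_II N.+1) => c [].
  by apply: bigcup_finite => [|f _]; [exact: finite_fset|exact: fiber_finite].
move=> /(infinite_setD q_inf)/infinite_setN0[e [eq eD]]; exists e => // k l f f'.
wlog kl : k l f f' / (l <= k)%N => [th|] kN lN fF fF' E.
  case: (leqP l k) => [lk|/ltnW kl]; first exact: (th k l f f').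
  by apply/esym/(th l k f' f).
apply/eqP; rewrite eqn_mod_dvd //; apply/negPn/negP => qkl; apply: eD.
exists (k - l)%N; first by split=> //=; rewrite ltnS (leq_trans (leq_subr _ _)).
exists (f' - f); first by apply/imfset2P; exists f => //; exists f'.
by split=> //=; rewrite mulrnBr //; apply/eqP; rewrite subr_eq addrAC eq_sym subr_eq E addrC.
Qed.

(** The head [e0] is chosen against [F], the tail against [F] enlarged by multiples of [e0]. In a
    relation the tail coefficients are therefore congruent, the tails cancel, and a relation for
    [e0] alone remains. *)
Lemma generic_seq N (I : finType) (r : seq I) F : uniq r -> exists e : I -> G,
  (forall i, e i *+ q = 0) /\
  forall k l : I -> nat, (forall i, k i <= N)%N -> (forall i, l i <= N)%N ->
  forall f f', f \in F -> f' \in F ->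
  \sum_(i <- r) e i *+ k i + f = \sum_(i <- r) e i *+ l i + f' ->
  forall i, i \in r -> k i = l i %[mod q].
Proof.
elim: r F => [|i r IH] F /=; first by exists (fun=> 0); split=> // i; rewrite mul0rn.
case/andP=> ir ur; have [e0 e0q e0F] := generic1 N F.
have [e [eq eF]] := IH [fset f + e0 *+ k | f in F, k in iota 0 N.+1] ur.
pose e' j := if j == i then e0 else e j.
exists e'; split=> [j|k l kN lN f f' fF fF']; first by rewrite /e'; case: eqP.
have sumE m : \sum_(j <- r) e' j *+ m j = \sum_(j <- r) e j *+ m j.
  by apply: eq_big_seq => j jr; rewrite /e'; case: eqP ir => // <-; rewrite jr.
have memF m g : (forall j, m j <= N)%N -> g \in F ->
    g + e0 *+ m i \in [fset f + e0 *+ k | f in F, k in iota 0 N.+1].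
  move=> mN gF; apply/imfset2P; exists g => //; exists (m i); last by [].
  by change (m i \in iota 0 N.+1); rewrite mem_iota ltnS mN.
rewrite !big_cons !sumE {1 2}/e' eqxx => E.
have klr j : j \in r -> k j = l j %[mod q].
  apply: (eF k l kN lN _ _ (memF k f kN fF) (memF l f' lN fF')).
  by rewrite [f + _]addrC [f' + _]addrC !addrA ![_ + e0 *+ _]addrC.
move=> j; rewrite inE => /predU1P[->|/klr//].
apply: (e0F _ _ f f') => //; move: E.
have -> : \sum_(x <- r) e x *+ k x = \sum_(x <- r) e x *+ l x.
  by apply: eq_big_seq => x /klr; exact: mulrn_modq.
by rewrite -!addrA ![e0 *+ _ + (_ + _)]addrCA => /addrI.
Qed.

Lemma generic_exists N F (I : finType) : exists e : I -> G, generic q N F e.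
Proof.
have [e [eq eF]] := generic_seq N F (index_enum_uniq I).
exists e; split=> // k l kN lN f f' fF fF' E i.
exact: eF E i (mem_index_enum i).
Qed.

End Critical.
End GenericElements.

Lemma infinite_avoid (G : zmodType) (F : {fset G}) :
  infinite_set [set: G]%classic -> exists t, t \notin F.
Proof.
move=> infG; have /infinite_setN0[t [_ /negP tF]] :=
  infinite_setD infG (finite_fset F).
by exists t.
Qed.

(** * A tensor product of small sets *)

(** The translates [x + Y] are pairwise disjoint. *)
Lemma card_msum_unique (G : zmodType) (X Y : {fset G}) :
  (forall x x' y y', x \in X -> x' \in X -> y \in Y -> y' \in Y ->
     x + y = x' + y' -> x = x') ->
  #|` msum X Y| = (#|` X| * #|` Y|)%N.
Proof.
move=> inj; rewrite (_ : msum X Y = \big[fsetU/fset0]_(x : X) msum [fset val x] Y).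
  rewrite card_bigfcup_disjoint => [|x x' z _ _].
    rewrite (eq_bigr (fun=> #|` Y|)) => [|x _]; last exact: card_translate.
    by rewrite sum_nat_const -cardfE.
  move=> /msum_translateP[y yY ->] /msum_translateP[y' y'Y E].
  by apply/val_inj/(inj _ _ _ _ _ _ yY y'Y E); exact: valP.
apply/fsetP => z; apply/msumP/bigfcupP => [[x xX [y yY ->]]|[x _]].
  exists [` xX]; first by rewrite mem_index_enum.
  by apply/msum_translateP; exists y.
by move=> /msum_translateP[y yY ->]; exists (val x); [exact: valP|exists y].
Qed.

Lemma size_undup_map (T T1 T2 : eqType) (f : T -> T1) (g : T -> T2) (s : seq T) :
  {in s &, forall x y, (f x == f y) = (g x == g y)} ->
  size (undup (map f s)) = size (undup (map g s)).
Proof.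
elim: s => [//|x s IH] fg /=.
have -> : (f x \in map f s) = (g x \in map g s).
  apply/mapP/mapP => -[y ys /eqP E]; exists y => //; apply/eqP; move: E;
    by rewrite fg // inE ?eqxx // ys orbT.
by case: ifP; rewrite /= IH // => y z ys zs; apply: fg; rewrite inE ?ys ?zs orbT.
Qed.

Lemma card_big_msum (G : zmodType) (I : eqType) (r : seq I) (W : I -> {fset G}) :
  uniq r -> (forall i, 0 \in W i) ->
  (forall w w' : I -> G, (forall i, w i \in W i) -> (forall i, w' i \in W i) ->
     \sum_(i <- r) w i = \sum_(i <- r) w' i -> forall i, i \in r -> w i = w' i) ->
  #|` \big[msum/[fset 0]]_(i <- r) W i| = (\prod_(i <- r) #|` W i|)%N.
Proof.
move=> + W0; elim: r => [|i r IH] /=; first by rewrite !big_nil cardfs1.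
case/andP=> ir ur uW; rewrite !big_cons.
(* The uniqueness hypothesis concerns families lying in [W] at every index, so partial choices are
   extended by 0 outside [i :: r]. *)
pose glue x (w : I -> G) j :=
  if j == i then x else if j \in r then w j else 0.
have glueW x w : x \in W i -> (forall j, j \in r -> w j \in W j) ->
    forall j, glue x w j \in W j.
  by move=> xW wW j; rewrite /glue; case: eqP => [->//|_]; case: ifP => // /wW.
have glue_sum x w : \sum_(j <- i :: r) glue x w j = x + \sum_(j <- r) w j.
  rewrite big_cons {1}/glue eqxx; congr (_ + _); apply: eq_big_seq => j jr.
  by rewrite /glue jr; case: eqP ir => // <-; rewrite jr.
rewrite card_msum_unique ?IH // => [w w' wW w'W E j jr|x x' y y' xW x'W].
  have := uW _ _ (glueW 0 w (W0 i) (fun j _ => wW j))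
                 (glueW 0 w' (W0 i) (fun j _ => w'W j)).
  rewrite !glue_sum E => /(_ erefl j); rewrite inE jr orbT /glue jr => /(_ isT).
  by case: eqP ir => // <-; rewrite jr.
move=> /mem_big_msum-/(_ ur)[w wW ->] /mem_big_msum-/(_ ur)[w' w'W ->].
rewrite -!glue_sum => /(uW _ _ (glueW _ _ xW wW) (glueW _ _ x'W w'W)) /(_ i).
by rewrite mem_head /glue eqxx => ->.
Qed.

(** * Small combinations of two generators *)

Section PatternSets.
Variable G : zmodType.

(** Pairs of coefficients stand for group elements, so that sizes reduce to computations on lists
    that do not involve [G]. *)
Definition pval (c d : G) (p : nat * nat) := c *+ p.1 + d *+ p.2.
Definition pset (c d : G) (s : seq (nat * nat)) : {fset G} :=
  [fset x in map (pval c d) s].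
Definition psum (s t : seq (nat * nat)) :=
  [seq (p.1 + p'.1, p.2 + p'.2)%N | p <- s, p' <- t].

Lemma psetP c d s x : reflect (exists2 p, p \in s & x = pval c d p) (x \in pset c d s).
Proof. by rewrite inE; exact: mapP. Qed.

Lemma msum_pset c d s t : msum (pset c d s) (pset c d t) = pset c d (psum s t).
Proof.
have pvalD p p' : pval c d (p.1 + p'.1, p.2 + p'.2)%N = pval c d p + pval c d p'.
  by rewrite /pval /= !mulrnDr addrACA.
apply/fsetP => z; apply/msumP/psetP.
  move=> [_ /psetP[p ps ->] [_ /psetP[p' p't ->] ->]].
  by exists (p.1 + p'.1, p.2 + p'.2)%N; rewrite ?pvalD //; apply/allpairsP; exists (p, p').
move=> [_ /allpairsP[[p p'] [/= ps p't ->]] ->]; rewrite pvalD.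
by exists (pval c d p); [|exists (pval c d p')] => //; apply/psetP; [exists p|exists p'].
Qed.

End PatternSets.

(* Separates the classes modulo [q <> 1] only for arguments at most 2. *)
Definition residue q k := if q == 2%N then (k %% 2)%N else k.
Definition residue2 q (p : nat * nat) := (residue q p.1, residue q p.2).

Lemma residueP q k l : q != 1%N -> (k <= 2)%N -> (l <= 2)%N ->
  reflect (k = l %[mod q]) (residue q k == residue q l).
Proof.
move=> q1 k2 l2; rewrite /residue; case: (q =P 2%N) => [->|q2]; first exact: eqP.
apply: (iffP eqP) => [->//|]; case: q q1 q2 => [|[|[|q]]] // _ _.
by rewrite !modn_small // ltnS ?(leq_trans k2) ?(leq_trans l2).
Qed.

(* In a 2-torsion group the simpler [{0, c}] is a subgroup, so that the sizes
   [|Z + {0, c}|] are all even. *)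
Definition patC : seq (nat * nat) := [:: (0, 0); (1, 0); (0, 1)]%N.
Definition patZ (z : 'I_3) := take z.+1 patC.
Definition pat (z : 'I_3) (b : bool) :=
  psum (patZ z) (if b then patC else [:: (0, 0)%N]).
(** For [c], [d] generic modulo [q], this is the size of the set with pattern [patZ z], enlarged by
    [{0, c, d}] when [b] holds. *)
Definition patw q z b := size (undup (map (residue2 q) (pat z b))).

(* For [z = 0, 1, 2] the pairs [(patw q z false, patw q z true)] are (1, 3),
   (2, 4), (3, 4) if [q = 2] and (1, 3), (2, 5), (3, 6) otherwise; in both cases
   they generate [Z^2]. *)
Lemma patw_unimodular q : exists a : 'I_3 -> bool -> int,
  forall b b', \sum_z a z b * (patw q z b')%:Z = (b == b')%:Z.
Proof.
(* For each [b], the integer combination of the three pairs of sizes that gives the unit vector at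
   [b]. *)
exists (fun z b => nth 0 (if q == 2%N
  then if b then [:: 3; -3; 1] else [:: -8; 9; -3]
  else if b then [:: 2; -1; 0] else [:: -5; 3; 0]) z).
rewrite /patw /residue2 /residue; case: (q == 2%N);
  by case; case; rewrite !big_ord_recl big_ord0.
Qed.

Lemma pat_le2 z b p : p \in pat z b -> (p.1 <= 2)%N && (p.2 <= 2)%N.
Proof.
have : all (fun p => (p.1 <= 2) && (p.2 <= 2))%N (pat z b).
  by case: z b => [[|[|[|//]]]] lt [].
by move=> /allP; apply.
Qed.

Lemma pat0 z b : (0, 0)%N \in pat z b.
Proof. by case: z b => [[|[|[|//]]]] lt []. Qed.

(** [X z] is the sum over [i] of sets with pattern [patZ (z i)]. Adding [C i] alters only the term
    at [i], and independence of all the generators makes the sizes multiply. *)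
Lemma tensor_gadget (G : zmodType) (q : nat) (K : finType) : q != 1%N ->
  infinite_set (@torsion G q) ->
  (forall c, ~~ (q %| c)%N -> finite_set (@torsion G q `&` @torsion G c)%classic) ->
  exists (C : K -> {fset G}) (X : {ffun K -> 'I_3} -> {fset G}),
  forall (z : {ffun K -> 'I_3}) (J : {set K}),
    #|` msum (X z) (\big[msum/[fset 0]]_(i in J) C i)| =
    (\prod_i patw q (z i) (i \in J))%N.
Proof.
move=> q1 infq critq.
(* Two generators for each index; the coefficients in [pat] are at most 2 and there is no error
   term, hence the bound 2 and the set [{0}]. *)
have [e [eq e_gen]] := generic_exists infq critq 2 [fset 0] (K * bool)%type.
pose c i := e (i, false); pose d i := e (i, true).
exists (fun i => pset (c i) (d i) patC).
exists (fun z => \big[msum/[fset 0]]_i pset (c i) (d i) (patZ (z i))) => z J.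
rewrite [X in msum _ X]big_mkcond -big_split /=.
have WE i : msum (pset (c i) (d i) (patZ (z i)))
    (if i \in J then pset (c i) (d i) patC else [fset 0]) =
    pset (c i) (d i) (pat (z i) (i \in J)).
  rewrite -msum_pset; congr msum; case: ifP => // _.
  by apply/fsetP => x; rewrite !inE /pval /= !mulr0n addr0 orbF.
rewrite (eq_bigr _ (fun i _ => WE i)).
have inj (s s' : K -> nat * nat) :
    (forall i, s i \in pat (z i) (i \in J)) ->
    (forall i, s' i \in pat (z i) (i \in J)) ->
    \sum_i pval (c i) (d i) (s i) = \sum_i pval (c i) (d i) (s' i) ->
    forall i, residue2 q (s i) = residue2 q (s' i).
  move=> sP s'P E i.
  pose k (t : K -> nat * nat) (x : K * bool) := if x.2 then (t x.1).2 else (t x.1).1.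
  have k2 t : (forall i, t i \in pat (z i) (i \in J)) -> forall x, (k t x <= 2)%N.
    by move=> tP [j b]; have /andP[] := pat_le2 (tP j); rewrite /k /=; case: b.
  have kE t : \sum_x e x *+ k t x = \sum_i pval (c i) (d i) (t i).
    transitivity (\sum_i \sum_(b : bool) e (i, b) *+ k t (i, b)).
      by rewrite pair_bigA; apply: eq_bigr => -[].
    by apply: eq_bigr => j _; rewrite big_bool; exact: addrC.
  have := e_gen _ _ (k2 s sP) (k2 s' s'P) 0 0 (fset11 _) (fset11 _).
  rewrite !kE E => /(_ erefl) km; congr (_, _); apply/eqP/residueP => //.
  - exact: (k2 s sP (i, false)).
  - exact: (k2 s' s'P (i, false)).
  - exact: (km (i, false)).
  - exact: (k2 s sP (i, true)).
  - exact: (k2 s' s'P (i, true)).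
  - exact: (km (i, true)).
have pval_res i p p' : (p.1 <= 2)%N && (p.2 <= 2)%N -> (p'.1 <= 2)%N && (p'.2 <= 2)%N ->
    residue2 q p = residue2 q p' -> pval (c i) (d i) p = pval (c i) (d i) p'.
  move=> /andP[p1 p2] /andP[p1' p2'] [/eqP r1 /eqP r2].
  by congr (_ + _); apply: (mulrn_modq (eq _)); apply/residueP.
rewrite card_big_msum ?index_enum_uniq // => [|i|w w' wW w'W E i _].
- apply: eq_bigr => i _; rewrite /patw card_fseq; apply: size_undup_map => p p' ps p's.
  apply/eqP/eqP => [E|]; last by apply: pval_res; [exact: pat_le2 ps|exact: pat_le2 p's].
  (* Two values at the single index [i] are compared by padding with the zero pair at all other
     indices. *)
  pose at_i t j := if j == i then t else (0, 0)%N.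
  have at_pat t : t \in pat (z i) (i \in J) -> forall j, at_i t j \in pat (z j) (j \in J).
    by move=> tP j; rewrite /at_i; case: eqP => [->//|_]; exact: pat0.
  have := inj _ _ (at_pat p ps) (at_pat p' p's) _ i; rewrite /at_i eqxx; apply.
  rewrite (bigD1 i) //= [RHS](bigD1 i) //= eqxx E; congr (_ + _).
  by apply: eq_bigr => j /negPf ->.
- by apply/psetP; exists (0, 0)%N; rewrite ?pat0 // /pval /= !mulr0n addr0.
have /fin_all_exists2[s sP sE] j : exists2 p, p \in pat (z j) (j \in J) & w j = pval (c j) (d j) p.
  exact/psetP.
have /fin_all_exists2[s' s'P s'E] j : exists2 p, p \in pat (z j) (j \in J) & w' j = pval (c j) (d j) p.
  exact/psetP.
have := inj s s' sP s'P; rewrite -(eq_bigr _ (fun i _ => sE i)) -(eq_bigr _ (fun i _ => s'E i)).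
move=> /(_ E) r; rewrite sE s'E.
by apply: pval_res (r i); [exact: pat_le2 (sP i)|exact: pat_le2 (s'P i)].
Qed.

(** * Realizable differences *)

Section Realizable.
Variables (G : zmodType) (I : finType) (W : I -> {fset G}).
Hypothesis infG : infinite_set [set: G]%classic.

Definition realizable (g : I -> int) := exists X Y : {fset G},
  forall J, (#|` msum X (W J)|)%:Z - (#|` msum Y (W J)|)%:Z = g J.

(** One [t] outside finitely many differences keeps the two parts disjoint for all [J] at once. *)
Lemma msum_far_union (X Y : {fset G}) : exists t, forall J,
  #|` msum (X `|` msum [fset t] Y) (W J)| =
  (#|` msum X (W J)| + #|` msum Y (W J)|)%N.
Proof.
have [t tF] := infinite_avoid
  (\big[fsetU/fset0]_(J : I) [fset a - b | a in msum X (W J), b in msum Y (W J)]) infG.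
exists t => J; rewrite msumUl -msumA card_fsetU_disjoint ?card_translate //.
move=> a aX /msum_translateP[b bY ab]; case/negP: tF.
apply/bigfcupP; exists J; first by rewrite mem_index_enum.
by apply/imfset2P; exists a => //; exists b => //; rewrite ab addrK.
Qed.

Lemma realizable_ext g g' : g =1 g' -> realizable g -> realizable g'.
Proof. by move=> E [X [Y XY]]; exists X, Y => J; rewrite XY E. Qed.

Lemma realizable0 : realizable (fun=> 0).
Proof. by exists fset0, fset0 => J; rewrite subrr. Qed.

Lemma realizableN g : realizable g -> realizable (fun J => - g J).
Proof. by move=> [X [Y XY]]; exists Y, X => J; rewrite -XY opprB. Qed.

Lemma realizableD g g' :
  realizable g -> realizable g' -> realizable (fun J => g J + g' J).
Proof.
move=> [X [Y XY]] [X' [Y' XY']].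
have [[s sP] [t tP]] := (msum_far_union X X', msum_far_union Y Y').
exists (X `|` msum [fset s] X'), (Y `|` msum [fset t] Y') => J.
by rewrite sP tP !PoszD opprD addrACA XY XY'.
Qed.

Lemma realizable_card X : realizable (fun J => (#|` msum X (W J)|)%:Z).
Proof. by exists X, fset0 => J; rewrite msum_fset0 cardfs0 subr0. Qed.

Lemma realizableZ (a : int) g : realizable g -> realizable (fun J => a * g J).
Proof.
move=> rg; have rn n : realizable (fun J => n%:Z * g J).
  elim: n => [|n]; first by apply: realizable_ext realizable0 => J; rewrite mul0r.
  by move/(realizableD rg); apply: realizable_ext => J; rewrite -addn1 PoszD mulrDl mul1r addrC.
case: a => n; first exact: rn.
by apply: realizable_ext (realizableN (rn n.+1)) => J; rewrite NegzE mulNr.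
Qed.

Lemma realizable_sum (Z : finType) (g : Z -> I -> int) :
  (forall z, realizable (g z)) -> realizable (fun J => \sum_z g z J).
Proof.
move=> rg; elim: (index_enum Z) => [|z r IH].
  by apply: realizable_ext realizable0 => J; rewrite big_nil.
by apply: realizable_ext (realizableD (rg z) IH) => J; rewrite big_cons.
Qed.

(* The points [E] added to both sets span, up to a shift by the far away [u],
   everything the sets can add to [L]; they do not interfere with the count. *)
Lemma common_envelope (K : finType) (C : K -> {fset G}) (X Y : {fset G}) :
  exists L X' Y' : {fset G},
    [/\ 0 \in L, forall i, C i `<=` L, X' `<=` L /\ Y' `<=` L,
        msum L X' = msum L Y' &
        forall J, (#|` msum X' (W J)|)%:Z - (#|` msum Y' (W J)|)%:Z =
                  (#|` msum X (W J)|)%:Z - (#|` msum Y (W J)|)%:Z].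
Proof.
pose XY := X `|` Y.
(* [u] is not a difference of two points of [XY + W J], and by symmetry neither is [- u]; hence
   [E + W J] is disjoint from [XY + W J]. *)
have [u uF] := infinite_avoid (\big[fsetU/fset0]_(J : I)
  [fset a - b | a in msum XY (W J), b in msum XY (W J)]) infG.
pose E := msum [fset - u; u] XY.
pose V := 0 |` (XY `|` \big[fsetU/fset0]_(i : K) C i).
pose L := msum [fset - u; 0; u] V.
have V0 : 0 \in V by rewrite fset1U1.
have XYV : XY `<=` V by rewrite /V; apply: fsubset_trans (fsubsetUr _ _); exact: fsubsetUl.
have VL : V `<=` L.
  by rewrite -{1}[V]msum0 msumS // fsub1set !inE eqxx orbT.
have EL : E `<=` L.
  apply: msumS => //; apply/fsubsetP => x; rewrite !inE.
  by case/orP => ->; rewrite ?orbT.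
have LE Z : Z `<=` XY -> msum L (Z `|` E) = msum L E.
  move=> ZXY; rewrite msumUr; apply/fsetUidPr/fsubsetP => z.
  move=> /msumP[_ /msumP[s sU [v vV ->]] [x xZ ->{z}]].
  have xXY := fsubsetP ZXY x xZ.
  (* Splitting [s = s' + s''] with [s''] equal to [u] or [- u] rewrites [s + v + x] as
     [(s' + v) + (s'' + x)], a point of [L + E]. *)
  suff [s' s'L [s'' s''E ->]] : exists2 s', s' \in [fset - u; 0; u] &
      exists2 s'', s'' \in [fset - u; u] & s = s' + s''.
    by rewrite addrAC -[_ + x + v]addrA [x + v]addrC addrACA !mem_msum.
  move: sU; rewrite !inE -orbA => /or3P[] /eqP ->.
  - by exists 0; rewrite ?inE ?eqxx ?orbT //; exists (- u); rewrite ?inE ?eqxx ?add0r.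
  - by exists (- u); rewrite ?inE ?eqxx //; exists u; rewrite ?inE ?eqxx ?orbT ?addNr.
  - by exists 0; rewrite ?inE ?eqxx ?orbT //; exists u; rewrite ?inE ?eqxx ?orbT ?add0r.
have cardE Z J : Z `<=` XY ->
    #|` msum (Z `|` E) (W J)| = (#|` msum Z (W J)| + #|` msum E (W J)|)%N.
  move=> ZXY; rewrite msumUl card_fsetU_disjoint // => a.
  move=> /(fsubsetP (msumS ZXY (fsubset_refl _))) aZ; rewrite /E -msumA.
  move=> /msumP[s sU [b bXY ab]]; case/negP: uF; apply/bigfcupP.
  exists J; first by rewrite mem_index_enum.
  apply/imfset2P; move: sU; rewrite !inE => /orP[] /eqP sE.
    by exists b => //; exists a => //; rewrite ab sE opprD opprK addrC addrNK.
  by exists a => //; exists b => //; rewrite ab sE addrK.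
have XXY : X `<=` XY by exact: fsubsetUl.
have YXY : Y `<=` XY by exact: fsubsetUr.
exists L, (X `|` E), (Y `|` E); split.
- exact: fsubsetP VL 0 V0.
- move=> i; apply: fsubset_trans VL; apply: fsubset_trans (fsubsetUr _ _).
  by apply: fsubset_trans (fsubsetUr _ _); apply: bigfcup_sup; rewrite ?mem_index_enum.
- have ZL Z : Z `<=` XY -> Z `|` E `<=` L.
    by move=> ZXY; rewrite fsubUset EL andbT (fsubset_trans ZXY (fsubset_trans XYV VL)).
  by split; exact: ZL.
- by rewrite !LE.
- by move=> J; rewrite !cardE // !PoszD opprD addrACA subrr addr0.
Qed.

End Realizable.

(** Applying [patw_unimodular] at every index, the sizes of [X z + C_J] weighted by
    [\prod_i a (z i) (i \in J')] add up to the indicator of [J = J'], and indicators span all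
    integer-valued functions. *)
Lemma realizable_all (G : zmodType) (K : finType) (q : nat) : q != 1%N ->
  infinite_set (@torsion G q) ->
  (forall c, ~~ (q %| c)%N -> finite_set (@torsion G q `&` @torsion G c)%classic) ->
  infinite_set [set: G]%classic ->
  exists C : K -> {fset G}, forall g : {set K} -> int,
    realizable (fun J : {set K} => \big[msum/[fset 0]]_(i in J) C i) g.
Proof.
move=> q1 infq critq infG.
have [C [X CX]] := tensor_gadget K q1 infq critq; exists C => g.
have [a aw] := patw_unimodular q.
pose b (z : {ffun K -> 'I_3}) := \sum_(J : {set K}) g J * \prod_i a (z i) (i \in J).
apply: realizable_ext (realizable_sum infG
  (fun z => realizableZ infG (b z) (realizable_card _ (X z)))) => J.
transitivity (\sum_(z : {ffun K -> 'I_3}) \sum_(J' : {set K}) g J' *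
    \prod_i (a (z i) (i \in J') * (patw q (z i) (i \in J))%:Z)).
  apply: eq_bigr => z _; rewrite CX mulr_suml; apply: eq_bigr => J' _.
  by rewrite -mulrA big_split /= (big_morph Posz PoszM (erefl _)).
(* The sum over [z] becomes a product over indices. For [J'] other than [J], the factor at an index
   lying in exactly one of them vanishes. *)
rewrite exchange_big (bigD1 J) //= [X in _ + X]big1 => [|J' neJ]; rewrite -mulr_sumr.
  rewrite -(bigA_distr_bigA (fun i z => a z (i \in J) * (patw q z (i \in J))%:Z)).
  rewrite big1 => [|i _]; last by rewrite aw eqxx.
  by rewrite mulr1 addr0.
rewrite -(bigA_distr_bigA (fun i z => a z (i \in J') * (patw q z (i \in J))%:Z)).
have [i /negPf iJ] : exists i, (i \in J') != (i \in J).
  apply/existsP; apply: contraR neJ; rewrite negb_exists => /forallP E.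
  by apply/eqP/finset.setP => i; apply/eqP; have := E i; rewrite negbK.
by rewrite (bigD1 i) //= aw iJ mul0r mulr0.
Qed.

(** * The two-level gadget *)

Section Gadget.
Variables (G : zmodType) (q : nat) (K : finType) (e : K -> G) (L : {fset G}).
Variable H : nat.
Implicit Types (P : K -> {fset G}) (I J : {set K}).
Hypothesis q_neq1 : q != 1%N.
Hypothesis L0 : 0 \in L.
(** Each of at most [H] summands contributes at most twice one [e i], plus an element of [L]; hence
    the bound [2H] and the error set [HL]. *)
Hypothesis e_gen : generic q H.*2 (sumset H L) e.

(** The set [D]; the adjoined 0 puts [L] itself into it. *)
Definition doubles : {fset G} :=
  msum (0 |` \big[fsetU/fset0]_(i : K) [fset e i *+ 2]) L.

Definition gadget (P : K -> {fset G}) : {fset G} :=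
  doubles `|` \big[fsetU/fset0]_(i : K) msum [fset e i] (P i).

(** The part [D + (h-1)A] of [hA]. For [h = 0] no summand can come from [D], and [0A] is just the
    cell of the empty set. *)
Definition blocked h (P : K -> {fset G}) : {fset G} :=
  if h is h'.+1 then msum doubles (sumset h' (gadget P)) else fset0.

Definition cell (P : K -> {fset G}) (I : {set K}) : {fset G} :=
  msum [fset \sum_(i in I) e i] (\big[msum/[fset 0]]_(i in I) P i).

Definition sphere h (P : K -> {fset G}) : {fset G} :=
  \big[fsetU/fset0]_(I : {set K} | #|I| == h) cell P I.

Lemma doubles_sub P : doubles `<=` gadget P. Proof. exact: fsubsetUl. Qed.

Lemma mem_doubles l : l \in L -> l \in doubles.
Proof. by move=> lL; rewrite -[l]add0r mem_msum ?fset1U1. Qed.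

Lemma mem_doubles2 i l : l \in L -> e i *+ 2 + l \in doubles.
Proof.
move=> lL; rewrite mem_msum // in_fsetU; apply/orP; right.
by apply/bigfcupP; exists i; rewrite ?mem_index_enum // fset11.
Qed.

Lemma doublesP x : x \in doubles ->
  exists2 l, l \in L & x = l \/ exists i, x = e i *+ 2 + l.
Proof.
move=> /msumP[t tT [l lL ->]]; exists l => //; move: tT; rewrite in_fsetU.
case/orP => [/fset1P ->|/bigfcupP[i _ /fset1P ->]]; first by left; rewrite add0r.
by right; exists i.
Qed.

Lemma mem_gadget P i p : p \in P i -> e i + p \in gadget P.
Proof.
move=> pP; rewrite in_fsetU; apply/orP; right; apply/bigfcupP.
by exists i; rewrite ?mem_index_enum // mem_msum ?fset11.
Qed.

Lemma cellP P I x :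
  reflect (exists2 p, forall i, i \in I -> p i \in P i &
                      x = \sum_(i in I) e i + \sum_(i in I) p i)
          (x \in cell P I).
Proof.
have bigP z : reflect (exists2 p, forall i, i \in I -> p i \in P i &
                        z = \sum_(i in I) p i)
                      (z \in \big[msum/[fset 0]]_(i in I) P i).
  rewrite -big_enum; apply: (iffP (mem_big_msum _ _ (enum_uniq _))) => -[p pP zE];
    (exists p; first by move=> i; move: (pP i); rewrite mem_enum);
    by move: zE; rewrite big_enum.
apply: (iffP (msum_translateP _ _ _)) => [[_ /bigP[p pP ->] ->]|[p pP ->]].
  by exists p.
by exists (\sum_(i in I) p i) => //; apply/bigP; exists p.
Qed.

Lemma cell_sub_sumset P I : cell P I `<=` sumset #|I| (gadget P).
Proof.
apply/fsubsetP => _ /cellP[p pP ->]; rewrite -big_split /=.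
by apply: sum_in_sumset => i iI; apply: mem_gadget; apply: pP.
Qed.

(* Two summands in the same translate [e i + P i] can be traded for one in
   [2 e i + L] and one in [L]. *)
Lemma sumset_gadget h P : (forall i, P i `<=` L) ->
  sumset h (gadget P) = blocked h P `|` sphere h P.
Proof.
move=> PL; elim: h => [|h IH].
  rewrite sumset0 fset0U; apply/fsetP => x; apply/fset1P/bigfcupP => [->|[I]].
    exists finset.set0; first by rewrite mem_index_enum cards0.
    by apply/cellP; exists (fun=> 0); rewrite ?big_set0 ?addr0 // => i; rewrite inE.
  by rewrite cards_eq0 => /andP[_ /eqP ->] /cellP[p _ ->]; rewrite !big_set0 addr0.
apply/eqP; rewrite eqEfsubset; apply/andP; split; last first.
  rewrite fsubUset sumsetS msumS ?doubles_sub //=.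
  apply/fsubsetP => x /bigfcupP[I /andP[_ /eqP cI]].
  by move/(fsubsetP (cell_sub_sumset _ _)); rewrite cI sumsetS.
rewrite sumsetS {1}/gadget msumUl fsubUset fsubsetUl /=; apply/fsubsetP => x.
move=> /msumP[_ /bigfcupP[i _ /msum_translateP[p pP ->]] [y + ->]].
have pL := fsubsetP (PL i) p pP.
rewrite {1}IH => /fsetUP[yb|/bigfcupP[I /andP[_ /eqP cI] /cellP[r rP ->]]].
  rewrite in_fsetU; apply/orP; left; case: h yb {IH} => [|h] /=; first by rewrite inE.
  move=> /msumP[d dD [z zS ->]]; rewrite addrCA mem_msum // sumsetS.
  by rewrite mem_msum // mem_gadget.
rewrite in_fsetU; apply/orP; have [iI|iI] := boolP (i \in I).
  left; rewrite (bigD1 i iI) [X in _ + (_ + X)](bigD1 i iI) /=.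
  set E := \sum_(j in I | _) _; set R := \sum_(j in I | _) _.
  have -> : e i + p + (e i + E + (r i + R)) = (e i *+ 2 + p) + (r i + (E + R)).
    rewrite mulr2n -!addrA; congr (_ + _); rewrite addrCA.
    by congr (_ + (_ + _)); rewrite addrCA.
  have [h' hE] : exists h', h = h'.+1.
    by exists h.-1; rewrite prednK // -cI card_gt0; apply/finset.set0Pn; exists i.
  rewrite /= hE sumsetS mem_msum ?mem_doubles2 // mem_msum //.
    by apply/(fsubsetP (doubles_sub P))/mem_doubles/(fsubsetP (PL i))/rP.
  have -> : h' = #|I :\ i| by move: cI; rewrite (cardsD1 i) iI hE => -[].
  rewrite /E /R -big_split /=.
  rewrite (eq_bigl (mem (I :\ i))) => [|j]; last by rewrite !inE andbC.
  by apply: sum_in_sumset => j /finset.setD1P[_ jI]; apply: mem_gadget; apply: rP.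
right; apply/bigfcupP; exists (i |: I).
  by rewrite mem_index_enum cardsU1 iI cI eqxx.
apply/cellP; exists (fun j => if j == i then p else r j).
  by move=> j /finset.setU1P[->|jI]; rewrite ?eqxx //; case: eqP => [->|_] //; apply: rP.
rewrite !big_setU1 //= eqxx addrACA; congr (_ + (_ + _)).
by apply: eq_bigr => j jI; case: eqP iI => // <-; rewrite jI.
Qed.

(** * Coordinates along the generic elements and disjointness *)

Definition supp (k : K -> nat) := [set i | k i != 0%N].

Lemma sum_mulrn_update (k : K -> nat) j c :
  \sum_i e i *+ (k i + (if i == j then c else 0)) = \sum_i e i *+ k i + e j *+ c.
Proof.
transitivity (\sum_i (e i *+ k i + (if i == j then e j *+ c else 0))).
  by apply: eq_bigr => i _; rewrite mulrnDr; case: eqP => [->|].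
by rewrite big_split /= -big_mkcond big_pred1_eq.
Qed.

(** Every element of the gadget is a multiple, at most double, of a single [e j] plus an element of
    [L], so each summand adds at most one index to the support. *)
Lemma sumset_coords h P x : (forall i, P i `<=` L) -> x \in sumset h (gadget P) ->
  exists k l, [/\ forall i, (k i <= h.*2)%N, (#|supp k| <= h)%N,
                  l \in sumset h L & x = \sum_i e i *+ k i + l].
Proof.
move=> PL; elim: h x => [|h IH] x.
  rewrite sumset0 => /fset1P ->; exists (fun=> 0%N), 0; split=> //.
  - by rewrite (_ : supp _ = finset.set0) ?cards0 //; apply/finset.setP => i; rewrite !inE.
  - by rewrite sumset0 fset11.
  - by rewrite big1 ?addr0 // => i _; rewrite mulr0n.
rewrite sumsetS => /msumP[a aA [y /IH[k [l [k2 ks lS ->]]] ->]].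
suff [i [c [b [c2 bL ->]]]] : exists i c b, [/\ (c <= 2)%N, b \in L &
    a = (if i is Some j then e j *+ c else 0) + b].
  case: i => [j|]; last first.
    exists k, (b + l); split; first by move=> i; rewrite (leq_trans (k2 i)) // leq_double.
    - exact: leqW.
    - by rewrite sumsetS mem_msum.
    - by rewrite add0r addrCA.
  exists (fun i => k i + (if i == j then c else 0))%N, (b + l); split.
  - by move=> i; rewrite doubleS -addn2 leq_add //; case: eqP.
  - apply: leq_trans (_ : #|j |: supp k| <= _)%N.
      apply: subset_leq_card; apply/fintype.subsetP => i; rewrite !inE.
      by case: (i == j); rewrite ?addn0.
    by rewrite cardsU1 -add1n leq_add // leq_b1.
  - by rewrite sumsetS mem_msum.
  - by rewrite sum_mulrn_update addrACA [e j *+ c + _]addrC.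
move: aA; rewrite in_fsetU => /orP[/doublesP[b bL [->|[i ->]]]|].
- by exists None, 0%N, b; rewrite add0r.
- by exists (Some i), 2%N, b.
move=> /bigfcupP[i _ /msum_translateP[p pP ->]].
by exists (Some i), 1%N, p; split=> //; exact: (fsubsetP (PL i)).
Qed.

Lemma cell_coords P I x : (forall i, P i `<=` L) -> x \in cell P I ->
  exists2 l, l \in sumset #|I| L & x = \sum_i e i *+ (i \in I) + l.
Proof.
move=> PL /cellP[p pP ->]; exists (\sum_(i in I) p i).
  by apply: sum_in_sumset => i iI; apply/(fsubsetP (PL i))/pP.
congr (_ + _); rewrite big_mkcond; apply: eq_bigr => i _.
by case: (i \in I); rewrite ?mulr1n ?mulr0n.
Qed.

Lemma modq_bool (b b' : bool) : b = b' %[mod q] -> b = b'.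
Proof.
by move=> /eqP E; move: q_neq1; case: b b' E => -[] //;
   rewrite ?(eq_sym (0 %% q)%N) mod0n -/(dvdn q 1) dvdn1 => ->.
Qed.

(** Up to an error in [HL], the coefficients of a point of [cell P I] are the indicator of [I],
    which genericity recovers. *)
Lemma cell_disjoint h P I J x : (forall i, P i `<=` L) -> (h <= H)%N ->
  #|I| = h -> #|J| = h -> x \in cell P I -> x \in cell P J -> I = J.
Proof.
move=> PL hH cI cJ /cell_coords-/(_ PL)[l + ->] /cell_coords-/(_ PL)[l' + E].
rewrite cI cJ => /(fsubsetP (sumset_widen L0 hH)) lH.
move=> /(fsubsetP (sumset_widen L0 hH)) l'H.
have bound (A : {set K}) i : #|A| = h -> ((i \in A) <= H.*2)%N.
  move=> cA; case: (boolP (i \in A)) => // iA; rewrite double_gt0 (leq_trans _ hH) //.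
  by rewrite -cA card_gt0; apply/finset.set0Pn; exists i.
apply/finset.setP => i; apply: modq_bool.
exact: (e_gen.2 (fun i => i \in I) (fun i => i \in J)
  (fun i => bound I i cI) (fun i => bound J i cJ) l l').
Qed.

(* Each of the [h] summands involves at most one of the [e i], so reaching all
   [i] in [I] forces the first summand to be in some [2 e i + L] with [i] in [I]
   and the coefficient of [e i] to be 2 instead of 1. *)
Lemma blocked_cell_disjoint h P I x : (forall i, P i `<=` L) -> (h <= H)%N ->
  #|I| = h -> x \in blocked h P -> x \in cell P I -> False.
Proof.
case: h => [|h] PL hH cI; first by rewrite inE.
move=> /msumP[d /doublesP[b bL dE] [y /sumset_coords-/(_ PL)[k [l [k2 ks lS ->]]] xE]].
move=> /cell_coords-/(_ PL)[l' + xE']; rewrite cI.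
move=> /(fsubsetP (sumset_widen L0 hH)) l'H.
have blH : b + l \in sumset H L.
  by apply: (fsubsetP (sumset_widen L0 hH)); rewrite sumsetS mem_msum.
have bound i : ((i \in I) <= H.*2)%N.
  by rewrite (leq_trans (leq_b1 _)) // double_gt0 (leq_trans _ hH).
have hH2 i : (k i + 2 <= H.*2)%N.
  by rewrite addn2 (leq_trans (_ : _ <= h.*2.+2)%N) -?doubleS ?leq_double // doubleS !ltnS.
(* If the first summand lies in [L], the other [h] summands cannot reach all [h + 1] indices of
   [I]. *)
case: dE => [dE|[j dE]].
  have kI : forall i, k i = (i \in I) %[mod q].
    apply: (e_gen.2 _ _ _ bound (b + l) l') => // [i|].
      by rewrite (leq_trans _ (hH2 i)) // leq_addr.
    by rewrite -xE' xE dE addrCA.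
  have : I \subset supp k.
    apply/fintype.subsetP => i iI; rewrite inE; apply/negP => /eqP k0.
    by have := kI i; rewrite k0 iI => /(@modq_bool false true).
  by move/subset_leq_card/leq_trans/(_ ks); rewrite cI ltnn.
have kI : forall i, (k i + (if i == j then 2 else 0))%N = (i \in I) %[mod q].
  apply: (e_gen.2 _ _ _ bound (b + l) l') => // [i|].
    by rewrite (leq_trans _ (hH2 i)) // leq_add2l; case: eqP.
  by rewrite -xE' xE dE sum_mulrn_update [RHS]addrACA [e j *+ 2 + _]addrC.
(* The other [h] summands must reach [I] without [j]. Comparing sizes, [j] is in [I] and their
   support is exactly [I :\ j], so [e j] has coefficient 2. *)
have Isub : I :\ j \subset supp k.
  apply/fintype.subsetP => i; rewrite !inE => /andP[/negPf ij iI]; apply/negP => /eqP k0.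
  by have := kI i; rewrite k0 iI ij => /(@modq_bool false true).
have jI : j \in I.
  apply/negPn/negP => jI; have := subset_leq_card Isub.
  by move/leq_trans/(_ ks); move: cI; rewrite (cardsD1 j) (negPf jI) add0n => ->; rewrite ltnn.
have cIj : #|I :\ j| = h by move: cI; rewrite (cardsD1 j) jI => -[].
have kj0 : k j = 0%N.
  have : I :\ j = supp k by apply/eqP; rewrite eqEcard Isub cIj.
  by move/finset.setP/(_ j); rewrite !inE eqxx => /esym/negbFE/eqP.
have := kI j; rewrite kj0 eqxx jI => /eqP.
(* [2 = 1] modulo [q] cancels to [1 = 0]. *)
by rewrite (eqn_modDl 1 1 0) => /eqP/(@modq_bool true false).
Qed.

Lemma card_sumset_gadget h P : (forall i, P i `<=` L) -> (h <= H)%N ->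
  #|` sumset h (gadget P)| = (#|` blocked h P| +
    \sum_(I : {set K} | #|I| == h) #|` \big[msum/[fset 0%R]]_(i in I) P i|)%N.
Proof.
move=> PL hH; rewrite sumset_gadget // card_fsetU_disjoint.
  rewrite card_bigfcup_disjoint => [|I J x /eqP cI /eqP cJ]; last exact: cell_disjoint cI cJ.
  by congr addn; apply: eq_bigr => I _; rewrite card_translate.
by move=> x xb /bigfcupP[I /andP[_ /eqP cI]]; apply: blocked_cell_disjoint cI xb.
Qed.

(** In [(t + l) + (e i + p)] the part [l + p] lies in [L + P i = L + P' i], so [p] can be exchanged
    at the cost of changing [l]. *)
Lemma doubles_gadget P P' : (forall i, msum L (P i) = msum L (P' i)) ->
  msum doubles (gadget P) = msum doubles (gadget P').
Proof.
move=> LP; suff sub Q Q' : (forall i, msum L (Q i) = msum L (Q' i)) ->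
    msum doubles (gadget Q) `<=` msum doubles (gadget Q').
  by apply/eqP; rewrite eqEfsubset !sub.
move=> {P P'}{}LP; rewrite msumUr fsubUset msumS ?doubles_sub //=.
apply/fsubsetP => x /msumP[_ /msumP[t tT [l lL ->]]].
move=> [_ /bigfcupP[i _ /msum_translateP[p pQ ->]] ->{x}].
have : l + p \in msum L (Q i) by exact: mem_msum.
rewrite LP => /msumP[l' l'L [p' p'Q E]].
have -> : t + l + (e i + p) = (t + l') + (e i + p').
  by rewrite addrACA E addrACA.
by rewrite !mem_msum // mem_gadget.
Qed.

(** The copies of the gadget are exchanged one at a time, each being brought next to [D] by
    commutativity. *)
Lemma blocked_congr h P P' : (forall i, msum L (P i) = msum L (P' i)) ->
  blocked h P = blocked h P'.
Proof.
move=> LP; case: h => //= h; elim: h => [|h IH]; first by rewrite !sumset0.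
rewrite !sumsetS !msumA (doubles_gadget LP) ![msum doubles (gadget P')]msumC.
by rewrite -!(msumA (gadget P') doubles) IH.
Qed.

End Gadget.

(** * Choice of the two sets for prescribed differences *)

Lemma card_ord_lt n k : (k <= n)%N -> #|[set i : 'I_n | (i < k)%N]| = k.
Proof.
by move=> kn; rewrite -sum1dep_card (big_ord_narrow kn) sum1_card card_ord.
Qed.

Theorem corollary1p4 (G : zmodType) (infG : infinite_set [set: G]%classic)
    (H : nat) (H_gt0 : (0 < H)%N) (m : nat -> int) :
  exists A B : {fset G}, forall h : nat, (1 <= h <= H)%N ->
    (#|` sumset h A|)%:Z - (#|` sumset h B|)%:Z = m h.
Proof.
case: H H_gt0 => // n _; pose K := 'I_n.+1.
have [q [q1 infq critq]] := critical_torsion infG.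
have [C realC] := realizable_all K q1 infq critq infG.
pose initial k := [set i : K | (i < k)%N].
(* Among the sets [I] of size [h], only the initial segment is to contribute, with the full value
   [m h]; here [J] is [I] without 0, so [h = #|J| + 1]. *)
pose g (J : {set K}) := if ord0 |: J == initial #|J|.+1 then m #|J|.+1 else 0.
have [X [Y XY]] := realC g.
have [L [X' [Y' [L0 CL [XL YL] LXY cardXY]]]] :=
  common_envelope (fun J : {set K} => \big[msum/[fset 0]]_(i in J) C i) infG C X Y.
have [e e_gen] := generic_exists infq critq n.+1.*2 (sumset n.+1 L) K.
(* The two gadgets differ only at index 0, where [Z] is [X'] or [Y']. *)
pose P Z i := if i == ord0 :> K then Z else C i.
have PL Z : Z `<=` L -> forall i, P Z i `<=` L by move=> ZL i; rewrite /P; case: ifP.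
exists (gadget e L (P X')), (gadget e L (P Y')) => h /andP[h0 hH].
rewrite !(card_sumset_gadget q1 L0 e_gen) //; [|exact: PL|exact: PL].
(* Since [L + X' = L + Y'], the blocked parts coincide and cancel in the difference. *)
rewrite (blocked_congr e h (P' := P Y')) => [|i]; last by rewrite /P; case: ifP.
rewrite !PoszD opprD addrACA subrr add0r !(big_morph Posz PoszD (erefl _)) -sumrB.
rewrite (bigD1 (initial h)) /=; last by rewrite card_ord_lt.
have bigP Z (I : {set K}) : ord0 \in I -> \big[msum/[fset 0]]_(i in I) P Z i =
    msum Z (\big[msum/[fset 0]]_(i in I :\ ord0) C i).
  move=> I0; rewrite (big_setD1 _ I0) {1}/P eqxx; congr msum.
  by apply: eq_bigr => i /finset.setD1P[/negPf i0 _]; rewrite /P i0.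
have diffP (I : {set K}) : #|I| == h -> ord0 \in I ->
    (#|` \big[msum/[fset 0]]_(i in I) P X' i|)%:Z -
    (#|` \big[msum/[fset 0]]_(i in I) P Y' i|)%:Z =
    if I == initial h then m h else 0.
  move=> /eqP cI I0; rewrite !bigP // cardXY XY /g finset.setD1K //.
  by move: cI; rewrite (cardsD1 ord0) I0 add1n => ->.
rewrite diffP ?card_ord_lt ?eqxx ?inE // big1 ?addr0 // => I /andP[cI /negPf I_h].
(* A set [I] without 0 does not see the replaced component, so its two terms are equal. *)
have [I0|I0] := boolP (ord0 \in I); first by rewrite diffP // I_h.
apply/eqP; rewrite subr_eq0; apply/eqP; congr (#|` _|)%:Z.
by apply: eq_bigr => i iI; rewrite /P; case: eqP iI I0 => // -> ->.
Qed.
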